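(* Let $q,d$ be non-negative integers, let $Y\in(\mathbb{R}^d)^{\Omega_q}$, let $\mu_\theta:=(Y(\theta,-))_*U$ for $\theta\in\mathbb{R}^q$, and let $h\in\mathbf{SSS}(\mathbb{R}^d,\mathbb{R})=C^\infty(\mathbb{R}^d,\mathbb{R})$ be bounded with $\nabla h$ bounded. Assume that for every compact $K\subseteq\mathbb{R}^q$ there is a $U$-integrable $B_K:\Omega\to[0,\infty]$ such that $$\sup_{\theta\in K}\|\partial_\theta Y(\theta,\omega)\|\le B_K(\omega)\qquad\text{for all }\omega\in\Omega.$$ Then $\theta\mapsto\int h\,d\mu_\theta$ is continuously differentiable on $\mathbb{R}^q$, with $$\nabla_\theta\int h\,d\mu_\theta=\int_\Omega\partial_\theta Y(\theta,\omega)^\top\,\nabla h(Y(\theta,\omega))\;U(d\omega).$$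
   Context: $\Omega=[0,1]^{\mathbb{N}}$; $\mathcal{B}_\Omega$ is the universal completion of its Borel (product) $\sigma$-algebra, i.e. the $\sigma$-algebra of all universally measurable subsets; $U=\bigotimes_{n\in\mathbb{N}}U[0,1]$ is the uniform probability measure on $\mathcal{B}_\Omega$. $\Omega_q:=\mathbb{R}^q\times\Omega$. The set $(\mathbb{R}^d)^{\Omega_q}$ consists of all maps $Y:\mathbb{R}^q\times\Omega\to\mathbb{R}^d$ such that (M1) $Y(-,\omega)\in C^\infty(\mathbb{R}^q,\mathbb{R}^d)$ for every $\omega\in\Omega$, and (M2) $Y(\theta,-)$ is $\mathcal{B}_\Omega$-Borel measurable for every $\theta\in\mathbb{R}^q$. Here $\mathbf{SSS}(\mathbb{R}^d,\mathbb{R})$ denotes the morphisms of Cartesian spaces in the category of sample-smooth spaces, which are exactly the $C^\infty$ functions. $\partial_\theta Y(\theta,\omega)$ is the $d\times q$ Jacobian matrix in $\theta$. *)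

(* Defs.v *)
From HB Require Import structures.
From mathcomp Require Import all_boot all_order all_algebra.
From mathcomp Require Import all_classical all_reals all_analysis.
From mathcomp Require Import measurable_realfun.

Set Implicit Arguments.
Unset Strict Implicit.
Unset Printing Implicit Defensive.
Import Order.TTheory GRing.Theory Num.Theory.
Import numFieldNormedType.Exports.

Local Open Scope classical_set_scope.
Local Open Scope ring_scope.

Section universal_completion.
Context d (T : measurableType d) (R : realType).

(* [completed_algebra_gen P] is the family of all sets [A `|` N] with [A]
   measurable and [N] contained in a measurable [P]-null set, i.e. the
   sigma-algebra completed with respect to [P]. *)
Definition universally_measurable (A : set T) : Prop :=
  forall P : probability T R, completed_algebra_gen P A.

Lemma universally_measurable0 : universally_measurable set0.
Proof.
move=> P; exists set0 => //; exists set0; first exact: negligible_set0.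
by rewrite setU0.
Qed.

Lemma universally_measurableC (A : set T) :
  universally_measurable A -> universally_measurable (~` A).
Proof.
move=> mA P; have [B mB [N [F [mF F0 NF]] BNA]] := mA P.
exists (~` B `\` F); first by apply: measurableD => //; exact: measurableC.
exists ((F `\` N) `&` ~` B).
  by exists F; split => // x [[]].
rewrite -BNA; apply/seteqP; split => [x [[nB nF]|[[Fx nN] nB]] []//|x nBN].
  by move/NF.
have nB : ~ B x by move=> Bx; apply: nBN; left.
have nN : ~ N x by move=> Nx; apply: nBN; right.
by have [Fx|nF] := pselect (F x); [right|left].
Qed.

Lemma universally_measurable_bigcup (A : (set T)^nat) :
  (forall n, universally_measurable (A n)) ->
  universally_measurable (\bigcup_n A n).
Proof.
move=> mA P.
have /choice[BN hBN] : forall n, exists BN : set T * set T,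
    [/\ measurable BN.1, P.-negligible BN.2 & BN.1 `|` BN.2 = A n].
  by move=> n; have [B mB [N nN BNA]] := mA n P; exists (B, N).
exists (\bigcup_n (BN n).1).
  by apply: bigcupT_measurable => n; have [] := hBN n.
exists (\bigcup_n (BN n).2).
  by apply: negligible_bigcup => n; have [] := hBN n.
by rewrite -bigcupU; apply: eq_bigcup => // n _; have [] := hBN n.
Qed.

End universal_completion.

Definition universal_display : measure_display -> measure_display.
Proof. exact. Qed.

(* [T] equipped with the universal completion of its sigma-algebra *)
Definition universal_completion (R : realType) d (T : measurableType d) : Type :=
  T.

HB.instance Definition _ (R : realType) d (T : measurableType d) :=
  Pointed.on (universal_completion R T).
HB.instance Definition _ (R : realType) d (T : measurableType d) :=
  @isMeasurable.Build (universal_display d) (universal_completion R T)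
    (@universally_measurable d T R) (@universally_measurable0 d T R)
    (@universally_measurableC d T R) (@universally_measurable_bigcup d T R).

Section sample_space.
Context (R : realType).

Definition hilbert_cube : Type := nat -> {i01 R}.

HB.instance Definition _ := Choice.on hilbert_cube.
HB.instance Definition _ := isPointed.Build hilbert_cube (fun=> 0%:i01).

Definition coordinate (n : nat) (w : hilbert_cube) : R := (w n)%:num.

Definition cylinders : set (set hilbert_cube) :=
  \bigcup_n preimage_set_system setT (coordinate n) measurable.

Definition Omega := universal_completion R (g_sigma_algebraType cylinders).

(* [U] is the product of countably many copies of U[0,1]; this determines the
   probability measure [U] on [Omega] uniquely, since the finite-dimensional
   boxes form a pi-system generating the product sigma-algebra and a measure
   has at most one extension to universally measurable sets. *)
Definition product_uniform (U : probability Omega R) : Prop :=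
  forall (n : nat) (A : nat -> set R), (forall i, measurable (A i)) ->
    U [set w : Omega | forall i, (i < n)%N -> A i (coordinate i w)] =
    (\prod_(i < n) uniform_prob (@ltr01 R) (A i))%E.

End sample_space.

Definition borel (T : ptopologicalType) := g_sigma_algebraType (@open T).

Section differential_calculus.
Context (R : realType).

Definition basis_vector n (i : 'I_n) : 'rV[R]_n := delta_mx ord0 i.

Fixpoint Ck (W : normedModType R) n (k : nat) (f : 'rV[R]_n -> W) : Prop :=
  match k with
  | 0 => continuous f
  | k'.+1 => (forall x, differentiable f x) /\
             forall i : 'I_n, Ck k' ('D_(basis_vector i) f)
  end.

Definition Cinfty (W : normedModType R) n (f : 'rV[R]_n -> W) : Prop :=
  forall k, Ck k f.

Definition gradient n (f : 'rV[R]_n -> R) (x : 'rV[R]_n) : 'cV[R]_n :=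
  \col_i 'D_(basis_vector i) f x.

(* Points of R^n are row vectors, and the library's ['J f x] acts on them by
   right multiplication; the usual Jacobian matrix, with one row for each
   component of [f], is its transpose. *)
Definition Jacobian n m (f : 'rV[R]_n -> 'rV[R]_m) (x : 'rV[R]_n) :
  'M[R]_(m, n) := ('J f x)^T.

End differential_calculus.

Section sample_smooth_maps.
Context (R : realType) (q d : nat).

Definition sample_smooth (Y : 'rV[R]_q -> Omega R -> 'rV[R]_d) : Prop :=
  (forall w, Cinfty (fun theta => Y theta w)) /\
  (forall theta, measurable_fun setT (Y theta : Omega R -> borel 'rV[R]_d)).

Definition dtheta (Y : 'rV[R]_q -> Omega R -> 'rV[R]_d)
    (theta : 'rV[R]_q) (w : Omega R) : 'M[R]_(d, q) :=
  Jacobian (fun t => Y t w) theta.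

Definition law (U : probability (Omega R) R)
    (Y : 'rV[R]_q -> Omega R -> 'rV[R]_d) (theta : 'rV[R]_q) :
    set (borel 'rV[R]_d) -> \bar R :=
  pushforward U (Y theta : Omega R -> borel 'rV[R]_d).

End sample_smooth_maps.

Section vector_integral.
Context d (T : measurableType d) (R : realType) (mu : {measure set T -> \bar R}).

Definition vintegrable n (f : T -> 'cV[R]_n) : Prop :=
  forall i, mu.-integrable setT (fun w => (f w i ord0)%:E).

Definition vintegral n (f : T -> 'cV[R]_n) : 'cV[R]_n :=
  \col_i (\int[mu]_w f w i ord0).

End vector_integral.

(* Main.v *)
Require Import Defs.
From HB Require Import structures.
From mathcomp Require Import all_boot all_order all_algebra.
From mathcomp Require Import all_classical all_reals all_analysis.
From mathcomp Require Import measurable_realfun.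

(** By change of variables, [F theta] is the integral over the sample space of
    [f theta w := h (Y theta w)], so the theorem is differentiation under the
    integral sign for a family of C^1 functions of several variables.

    The chain rule ([gradient_comp]) gives
    [gradient (f ^~ w) theta = (dtheta Y theta w)^T *m gradient h (Y theta w)],
    whose norm is at most a constant times [`|dtheta Y theta w|] because the
    gradient of [h] is bounded.  Applied to the closed unit ball around [theta],
    which is compact, the hypothesis on [Y] thus bounds the gradient of [f ^~ w]
    near [theta] by an integrable function of [w].

    The heart of the proof is [C1_under_integral].  Total differentiability of
    the integral is obtained directly, without going through partial
    derivatives: the first-order remainder of [f ^~ w] at [x] in direction [v],
    divided by [`|v|], tends to 0 with [v] for each [w], and by the mean value
    theorem it is bounded by twice a bound on the gradient along the segment.
    Dominated convergence says that its integral tends to 0 as well, which is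
    the differentiability of the integral, with the integral of the gradients as
    its gradient.  A second use of dominated convergence shows that this
    gradient depends continuously on [x].  Both uses are instances of
    [dominated_continuous_at], because the quotient above, which is 0 at [v = 0]
    by the convention on division, is a function of [v] continuous at 0. *)

Set Implicit Arguments.
Unset Strict Implicit.
Unset Printing Implicit Defensive.
Import Order.TTheory GRing.Theory Num.Theory.
Import numFieldNormedType.Exports.

Local Open Scope classical_set_scope.
Local Open Scope ring_scope.

(** * The max norm of matrices *)

Section max_norm.
Context (R : realType).

Lemma mx_norm_leP m n (A : 'M[R]_(m, n)) (e : R) : 0 <= e ->
  (`|A| <= e) <-> (forall i j, `|A i j| <= e).
Proof.
move=> e0; rewrite [`|A|]/Num.norm/= mx_normrE; split=> [Ae i j|Ae].
  by apply: le_trans Ae; exact: (le_bigmax _ _ (i, j)).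
by apply: bigmax_le => // -[i j] _; exact: Ae.
Qed.

Lemma ler_mx_entry m n (A : 'M[R]_(m, n)) i j : `|A i j| <= `|A|.
Proof. by apply: (mx_norm_leP A _).1. Qed.

Lemma mx_norm_tr m n (A : 'M[R]_(m, n)) : `|A^T| = `|A|.
Proof.
apply/eqP; rewrite eq_le; apply/andP; split; apply/mx_norm_leP => // i j.
  by rewrite mxE ler_mx_entry.
by rewrite -(trmxK A) mxE trmxK ler_mx_entry.
Qed.

(** The factor [n] is the number of terms in each entry of the product: the max
    norm is not submultiplicative. *)
Lemma ler_norm_mulmx m n p (A : 'M[R]_(m, n)) (B : 'M[R]_(n, p)) :
  `|A *m B| <= n%:R * (`|A| * `|B|).
Proof.
apply/mx_norm_leP => [|i k]; first by rewrite !mulr_ge0.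
rewrite mxE (le_trans (ler_norm_sum _ _ _))//.
rewrite (le_trans (ler_sum _ (G := fun=> `|A| * `|B|) _))//.
  by move=> j _; rewrite normrM ler_pM// ler_mx_entry.
by rewrite sumr_const card_ord mulr_natl.
Qed.

End max_norm.

(** * First-order calculus with gradients *)

Section gradient.
Context (R : realType).

Lemma diff_gradient n (f : 'rV[R]_n -> R) (x v : 'rV[R]_n) :
  differentiable f x -> 'd f x v = (v *m gradient f x) ord0 ord0.
Proof.
move=> df; rewrite [in LHS](row_sum_delta v) linear_sum mxE.
by apply: eq_bigr => i _; rewrite linearZ mxE deriveE.
Qed.

(** ['J f x] acts on row vectors by right multiplication, so its rows, not its
    columns, are the partial derivatives. *)
Lemma jacobian_row n m (f : 'rV[R]_n -> 'rV[R]_m) (x : 'rV[R]_n) i :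
  differentiable f x -> row i ('J f x) = 'D_(basis_vector R i) f x.
Proof. by move=> df; rewrite deriveEjacobian// rowE. Qed.

Lemma gradient_comp n m (f : 'rV[R]_n -> 'rV[R]_m) (g : 'rV[R]_m -> R) x :
  differentiable f x -> differentiable g (f x) ->
  gradient (g \o f) x = 'J f x *m gradient g (f x).
Proof.
move=> df dg; apply/colP => i; rewrite mxE deriveE; last first.
  exact: differentiable_comp.
rewrite diff_comp//= diff_gradient// -deriveE// -jacobian_row//.
by rewrite -row_mul mxE.
Qed.

(** Along a line the difference quotients of the restriction are those of [f] in
    direction [v]; this reduces statements about segments to one variable. *)
Lemma is_derive_line n (f : 'rV[R]_n -> R) (x v : 'rV[R]_n) (t : R) :
  differentiable f (x + t *: v) ->
  is_derive t 1 (fun s => f (x + s *: v)) ('d f (x + t *: v) v).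
Proof.
move=> df.
have E : (fun h : R => h^-1 *: (((fun s => f (x + s *: v)) \o shift t) (h *: 1)
             - f (x + t *: v))) =
    (fun h => h^-1 *: ((f \o shift (x + t *: v)) (h *: v) - f (x + t *: v))).
  apply/funext => h /=; congr (_ *: (f _ - _)).
  by rewrite [h%:A]mulr1 scalerDl addrCA.
have := @diff_derivable _ _ _ f (x + t *: v) v df.
move=> dv; split; first by rewrite /derivable E.
by rewrite -deriveE// /derive E.
Qed.

Lemma MVT_gradient n (f : 'rV[R]_n -> R) (x v : 'rV[R]_n) :
  (forall y, differentiable f y) ->
  exists2 t, t \in `[0, 1] &
    f (x + v) - f x = (v *m gradient f (x + t *: v)) ord0 ord0.
Proof.
move=> df.
have [|t t01] := @MVT_segment R (fun s => f (x + s *: v))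
    (fun s => 'd f (x + s *: v) v) 0 1 ler01 (fun s _ => is_derive_line (df _)).
  apply: derivable_within_continuous => s _.
  by have [] := @is_derive_line _ f x v s (df _).
rewrite scale1r scale0r addr0 subr0 mulr1 diff_gradient// => E.
by exists t.
Qed.

(** Differentiability expressed by a limit instead of a little-o, the form in
    which dominated convergence delivers it.  The limit may be taken over a full
    neighbourhood of 0 because the quotient is 0 at [v = 0]. *)
Lemma differentiable_gradient_lim n (f : 'rV[R]_n -> R) (x : 'rV[R]_n)
    (c : 'cV[R]_n) :
  (f (x + v) - f x - (v *m c) ord0 ord0) / `|v| @[v --> (0 : 'rV[R]_n)] --> 0 ->
  differentiable f x /\ gradient f x = c.
Proof.
move=> fc.
pose L (v : 'rV[R]_n) : R := (v *m c) ord0 ord0.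
have L_lin : linear L by move=> a u v; rewrite /L mulmxDl -scalemxAl !mxE.
pose LM := GRing.isLinear.Build _ _ _ _ _ L_lin.
pose LL : {linear 'rV[R]_n -> R} := HB.pack L LM.
have LLc : continuous LL.
  have -> : (LL : _ -> _) = fun v => \sum_(i < n) v ord0 i * c i ord0.
    by apply/funext => v; rewrite [LHS]mxE.
  apply: continuous_big => [|i _ v]; first exact: add_continuous.
  apply: (@cvgMr_tmp _ _ (nbhs v) _ (fun u : 'rV[R]_n => u ord0 i)).
  exact: coord_continuous.
have fE : f \o shift x = cst (f x) + LL +o_ (0 : 'rV[R]_n) id.
  apply/eqaddoP => e e0.
  move/cvgrPdist_le : fc => /(_ _ e0); apply: filterS => v.
  rewrite sub0r normrN normrM normfV normr_id.
  have -> : (f \o shift x - (cst (f x) + LL)) v = f (x + v) - f x - L v.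
    by rewrite !fctE /= opprD addrA [x + v]addrC.
  have [->|v0] := eqVneq v 0.
    by rewrite addr0 subrr sub0r /L mul0mx mxE oppr0 !normr0 mulr0.
  by rewrite ler_pdivrMr ?normr_gt0.
have dfE := diff_unique LLc fE.
have df : differentiable f x by apply/diff_locallyP; rewrite dfE.
split=> //; apply/colP => i; rewrite mxE deriveE// dfE /= /L.
by rewrite -rowE mxE.
Qed.

End gradient.

Section C1.
Context (R : realType) (n : nat).

Lemma Ck1P (f : 'rV[R]_n -> R) :
  Ck 1 f <-> (forall x, differentiable f x) /\ continuous (gradient f).
Proof.
split=> -[df cf]; split=> //; [move=> x|move=> i x].
  apply/(@cvgrPdist_le _ _ _ (nbhs x)) => /= e e0.
  have : \forall y \near x, forall i : 'I_n,
      `|'D_(basis_vector R i) f x - 'D_(basis_vector R i) f y| <= e.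
    apply: (@filter_forall _ _ _ (nbhs x)) => i.
    by move: (cf i x) => /cvgrPdist_le; exact.
  apply: filterS => y xy; apply/mx_norm_leP; first exact: ltW.
  by move=> i j; rewrite !mxE.
have -> : 'D_(basis_vector R i) f =
    (fun M : 'cV[R]_n => M i ord0) \o gradient f.
  by apply/funext => y /=; rewrite mxE.
exact: (continuous_comp (cf x) (@coord_continuous _ _ _ _ _ _)).
Qed.

End C1.

(** * Dominated convergence at a point *)

Section dominated_continuity.
Context (R : realType).

(** Balls of radius [n.+1%:R^-1] form a countable neighbourhood basis, so
    sequences detect limits at a point. *)
Lemma cvg_seq_nbhs (V W : normedModType R) (f : V -> W) (x : V) (l : W) :
  (forall u : nat -> V, u @ \oo --> x -> f (u n) @[n --> \oo] --> l) ->
  f y @[y --> x] --> l.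
Proof.
move=> fu; apply/cvgrPdist_le => /= e e0; apply: contrapT => nfe.
have /choice[u ux] (n : nat) : exists y, `|x - y| < n.+1%:R^-1 /\ ~ `|l - f y| <= e.
  apply: contrapT => nu; apply: nfe; apply/nbhs_ballP.
  exists n.+1%:R^-1 => /=; first by rewrite invr_gt0.
  move=> y; rewrite -ball_normE /= => xy.
  by apply: contrapT => ny; apply: nu; exists y.
have /fu/cvgrPdist_le/(_ _ e0)[N _ fe] : u @ \oo --> x.
  apply/cvgrPdist_lt => /= r r0.
  have /cvgrPdist_lt/(_ _ r0) := @cvg_harmonic R.
  apply: filterS => n; rewrite sub0r normrN ger0_norm//; last first.
    by rewrite invr_ge0.
  exact: lt_trans (ux n).1.
exact: (ux N).2 (fe N (leqnn N)).
Qed.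

(** The dominated convergence theorem concerns sequences; [cvg_seq_nbhs] turns it
    into a statement about continuity in a parameter.  The bound may take the
    value [+oo], as in the hypothesis of the main theorem. *)
Lemma dominated_continuous_at d (T : measurableType d)
    (mu : {measure set T -> \bar R}) (V : normedModType R) (f : V -> T -> R)
    (x : V) (B : T -> \bar R) :
  (forall y, measurable_fun setT (f y)) ->
  (forall w, f y w @[y --> x] --> f x w) ->
  mu.-integrable setT B ->
  (\forall y \near x, forall w, (`|f y w|%:E <= B w)%E) ->
  \int[mu]_w f y w @[y --> x] --> \int[mu]_w f x w.
Proof.
move=> mf cf iB fB; apply: cvg_seq_nbhs => u ux.
have [N _ uB] := ux _ fB.
(* Only the tail of the sequence is known to lie where [B] dominates. *)
rewrite -(@cvg_shiftn N).
have mf' y : measurable_fun setT (EFin \o f y) by exact/measurable_EFinP.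
have [||ifx _ cvf] := @dominated_convergence _ _ _ mu _ measurableT
    (fun n => EFin \o f (u (n + N)%N)) (EFin \o f x) B
    (fun n => mf' _) (mf' x) _ iB _.
- apply: aeW => w _; apply: cvg_EFin; first exact: nearW.
  by apply: (cvg_comp (fun n => u (n + N)%N) (f ^~ w)) (cf w); rewrite cvg_shiftn.
- by apply: aeW => w n _; apply: uB; exact: leq_addl.
by apply: fine_cvg; rewrite fineK//; exact: integrable_fin_num.
Qed.

End dominated_continuity.

(** * Linear functionals of a vector integral *)

Section vector_integral_theory.
Context d (T : measurableType d) (R : realType) (mu : {measure set T -> \bar R}).

Lemma vintegral_row_mul n (v : 'rV[R]_n) (f : T -> 'cV[R]_n) :
  vintegrable mu f ->
  mu.-integrable setT (fun w => ((v *m f w) ord0 ord0)%:E) /\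
  \int[mu]_w (v *m f w) ord0 ord0 = (v *m vintegral mu f) ord0 ord0.
Proof.
move=> fi.
pose g i w := ((v ord0 i)%:E * (f w i ord0)%:E)%E.
have gi i : mu.-integrable setT (g i) by exact: integrableZl (fi i).
have gE : (fun w => ((v *m f w) ord0 ord0)%:E) = (fun w => (\sum_(i < n) g i w)%E).
  by apply/funext => w; rewrite mxE -sumEFin.
split; first by rewrite gE; exact: integrable_sum.
rewrite /Rintegral gE integral_sum// -sum_fine; last first.
  by move=> i _; apply: integrable_fin_num.
rewrite mxE; apply: eq_bigr => i _; rewrite !mxE -RintegralZl//.
exact: fi.
Qed.

End vector_integral_theory.

(** * Differentiation under the integral sign in several variables *)

Section C1_under_integral.
Context d (T : measurableType d) (R : realType) (mu : {measure set T -> \bar R}).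
Context (n : nat) (f : 'rV[R]_n -> T -> R).
Hypothesis f_int : forall x, mu.-integrable setT (EFin \o f x).
Hypothesis f_C1 : forall w, Ck 1 (f ^~ w).
Hypothesis f_dom : forall x : 'rV[R]_n, exists B : T -> \bar R, mu.-integrable setT B /\
  \forall y \near x, forall w, (`|gradient (f ^~ w) y|%:E <= B w)%E.

Let df w x : differentiable (f ^~ w) x.
Proof. by have /Ck1P[] := f_C1 w. Qed.

Let mf x : measurable_fun setT (f x).
Proof. by apply/measurable_EFinP; exact: measurable_int (f_int x). Qed.

(** A partial derivative is a limit of a sequence of difference quotients, each
    of them measurable in [w]. *)
Let mgrad x i : measurable_fun setT (fun w => gradient (f ^~ w) x i ord0).
Proof.
pose h (k : nat) : R := k.+1%:R^-1.
apply: (@measurable_fun_cvg _ _ _ _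
  (fun k w => (h k)^-1 * (f (h k *: basis_vector R i + x) w - f x w))).
  move=> k; apply: measurable_funM => //.
  by apply: measurable_funB; exact: mf.
move=> w _; rewrite mxE.
have := @diff_derivable _ _ _ _ _ (basis_vector R i) (df w x).
move=> dfi.
apply: (@cvg_comp _ _ _ h
  (fun t => t^-1 *: (f (t *: basis_vector R i + x) w - f x w)) _ 0^') dfi.
move=> A [r /= r0 rA]; have /cvgrPdist_lt/(_ _ r0) := @cvg_harmonic R.
apply: filterS => k hk; apply: rA => //=.
by rewrite /h invr_eq0 pnatr_eq0.
Qed.

Lemma vintegrable_gradient x : vintegrable mu (fun w => gradient (f ^~ w) x).
Proof.
move=> i; have [B [iB /nbhs_singleton fB]] := f_dom x.
apply: (le_integrable _ _ _ iB) => //; first exact/measurable_EFinP.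
move=> w _; apply: le_trans (lee_abs _); apply: le_trans (fB w).
by rewrite lee_fin ler_mx_entry.
Qed.

Let F x := \int[mu]_w f x w.

(** The relative first-order remainder of [f ^~ w] at [x]; it is 0 at [v = 0]
    since [0^-1 = 0]. *)
Let remainder x v w :=
  (f (x + v) w - f x w - (v *m gradient (f ^~ w) x) ord0 ord0) / `|v|.

(** The increment of [f ^~ w] is a value of the differential at a point of the
    segment by the mean value theorem, so it has the same bound [n * b * `|v|] as
    the differential at [x]; hence the factor 2. *)
Let remainder_le x v w b :
  (forall t, t \in `[0, 1] -> `|gradient (f ^~ w) (x + t *: v)| <= b) ->
  `|remainder x v w| <= (n%:R * b) *+ 2.
Proof.
move=> fb; rewrite /remainder.
have fb0 : `|gradient (f ^~ w) x| <= b.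
  by have := fb 0; rewrite scale0r addr0; apply; rewrite in_itv/= lexx ler01.
have b0 : 0 <= b by exact: le_trans fb0.
have [->|v0] := eqVneq v 0.
  by rewrite normr0 invr0 mulr0 normr0 mulrn_wge0 ?mulr_ge0.
rewrite normrM normfV normr_id ler_pdivrMr ?normr_gt0// [_ *+ 2 * _]mulrnAl mulr2n.
have [t t01 ->] := @MVT_gradient _ _ _ x v (df w).
have le_vb (M : 'cV[R]_n) : `|M| <= b -> `|(v *m M) ord0 ord0| <= n%:R * b * `|v|.
  move=> Mb; apply: le_trans (ler_mx_entry _ _ _) _.
  apply: le_trans (ler_norm_mulmx _ _) _.
  by rewrite -mulrA ler_wpM2l// mulrC ler_wpM2r.
by apply: le_trans (ler_normB _ _) _; apply: lerD; apply: le_vb => //; exact: fb.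
Qed.

Let remainder_cvg x w : remainder x v w @[v --> (0 : 'rV[R]_n)] --> remainder x 0 w.
Proof.
rewrite {2}/remainder normr0 invr0 mulr0.
apply/(@cvgrPdist_le _ _ _ (nbhs (0 : 'rV[R]_n))) => e e0.
have /diff_locallyP[_ /eqaddoP/(_ _ e0)] := df w x.
apply: filterS => v; rewrite !fctE /= opprD addrA [v + x]addrC.
rewrite diff_gradient// sub0r normrN normrM normfV normr_id.
have [->|v0] := eqVneq v 0; first by move=> _; rewrite normr0 invr0 mulr0 ltW.
by rewrite ler_pdivrMr ?normr_gt0.
Qed.

Let integrableB_EFin (g h : T -> R) :
  mu.-integrable setT (EFin \o g) -> mu.-integrable setT (EFin \o h) ->
  mu.-integrable setT (EFin \o (fun w => g w - h w)).
Proof. by move=> ig ih; exact: eq_integrable (integrableB measurableT ig ih). Qed.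

Let remainder_integral x v :
  \int[mu]_w remainder x v w =
  (F (x + v) - F x
    - (v *m vintegral mu (fun w => gradient (f ^~ w) x)) ord0 ord0) / `|v|.
Proof.
have [iv <-] := vintegral_row_mul v (vintegrable_gradient x).
rewrite RintegralZr//.
  by rewrite RintegralB// ?RintegralB//; exact: integrableB_EFin.
by apply: integrableB_EFin => //; exact: integrableB_EFin.
Qed.

Let differentiable_integral x : differentiable F x /\
  gradient F x = vintegral mu (fun w => gradient (f ^~ w) x).
Proof.
apply: differentiable_gradient_lim.
under eq_fun do rewrite -remainder_integral.
have -> : 0 = \int[mu]_w remainder x 0 w :> R.
  by rewrite remainder_integral normr0 invr0 mulr0.
have [B [iB /nbhs_ballP[e /= e0 fB]]] := f_dom x.
(* The successor makes [k] positive even when [n = 0], so that [k%:E * B w] is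
   [+oo] wherever [B w] is. *)
pose k : R := (n * 2).+1%:R.
apply: (@dominated_continuous_at _ _ _ _ _ _ _ (fun w => (k%:E * B w)%E)).
- move=> v; apply: measurable_funM => //; apply: measurable_funB.
    exact: measurable_funB.
  have [iv _] := vintegral_row_mul v (vintegrable_gradient x).
  by apply/measurable_EFinP; exact: measurable_int iv.
- exact: remainder_cvg.
- exact: integrableZl.
apply/nbhs_ballP; exists e => //= v; rewrite -ball_normE /= sub0r normrN => ve w.
have {}fB t : t \in `[0, 1] ->
    (`|gradient (f ^~ w) (x + t *: v)|%:E <= B w)%E.
  rewrite in_itv /= => /andP[t0 t1]; apply: fB.
  rewrite -ball_normE /= opprD addrA subrr sub0r normrN normrZ ger0_norm//.
  by apply: le_lt_trans ve; rewrite ler_piMl.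
have k0 : 0 < k by [].
have := fB 0; rewrite in_itv /= lexx ler01 => /(_ isT).
case: (B w) fB => [b|_ _|_ /=]; last by [].
  move=> fB; rewrite lee_fin => /(le_trans (normr_ge0 _)) b0.
  rewrite -EFinM lee_fin.
  apply: le_trans (remainder_le (b := b) _) _ => [t /fB|]; first by rewrite lee_fin.
  by rewrite -mulrnAl -mulrnA ler_wpM2r// ler_nat leqnSn.
by rewrite gt0_muley ?lte_fin// leey.
Qed.

(** Continuity of the partial derivatives of [F] is dominated convergence once
    more, now that they are known to be the integrals of those of [f ^~ w]. *)
Theorem C1_under_integral :
  Ck 1 F /\ forall x, gradient F x = vintegral mu (fun w => gradient (f ^~ w) x).
Proof.
split; last by move=> x; have [] := differentiable_integral x.
split=> [x|i x]; first by have [] := differentiable_integral x.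
have DF y : 'D_(basis_vector R i) F y =
    \int[mu]_w gradient (f ^~ w) y i ord0.
  have /(congr1 (fun M : 'cV[R]_n => M i ord0)) := (differentiable_integral y).2.
  by rewrite !mxE.
have -> : 'D_(basis_vector R i) F =
    fun y => \int[mu]_w gradient (f ^~ w) y i ord0 by exact/funext.
have [B [iB fB]] := f_dom x.
apply: (dominated_continuous_at _ _ iB) => //.
  move=> w; have /Ck1P[_ cf] := f_C1 w.
  exact: (continuous_comp (cf x) (@coord_continuous _ _ _ _ _ _)).
apply: filterS fB => y fB w; apply: le_trans (fB w).
by rewrite lee_fin ler_mx_entry.
Qed.

End C1_under_integral.

(** * Composition, Borel measurability and compact balls *)

Section composition.
Context (R : realType).

Lemma Ck1_comp n m (f : 'rV[R]_n -> 'rV[R]_m) (g : 'rV[R]_m -> R) :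
  Ck 1 f -> Ck 1 g -> Ck 1 (g \o f).
Proof.
move=> [df cf] /Ck1P[dg cg]; split=> [x|i x].
  exact: differentiable_comp.
have -> : 'D_(basis_vector R i) (g \o f) = fun y =>
    \sum_(j < m) 'D_(basis_vector R i) f y ord0 j * gradient g (f y) j ord0.
  apply/funext => y.
  have /(congr1 (fun M : 'cV[R]_n => M i ord0)) := gradient_comp (df y) (dg (f y)).
  rewrite !mxE => ->; apply: eq_bigr => j _.
  by congr (_ * _); rewrite -jacobian_row// [RHS]mxE.
apply: continuous_big => [|j _ y]; first exact: add_continuous.
have cfj : {for y, continuous (fun z => 'D_(basis_vector R i) f z ord0 j)}.
  apply: (@continuous_comp _ _ _ ('D_(basis_vector R i) f)
    (fun M : 'rV[R]_m => M ord0 j)); [exact: cf | exact: coord_continuous].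
have cgj : {for y, continuous (fun z => gradient g (f z) j ord0)}.
  apply: (@continuous_comp _ _ _ f (fun z => gradient g z j ord0)).
    exact: differentiable_continuous.
  apply: (@continuous_comp _ _ _ (gradient g) (fun M : 'cV[R]_m => M j ord0));
    [exact: cg | exact: coord_continuous].
exact: cvgM cfj cgj.
Qed.

(** Open intervals generate the Borel sets of [R], and their preimages are open,
    hence among the generators of [borel T]. *)
Lemma continuous_borel_measurable (T : ptopologicalType) (f : T -> R) :
  continuous f -> measurable_fun setT (f : borel T -> R).
Proof.
move=> /continuousP cf; apply: (measurability _ (RGenOpens.measurableE R)).
move=> _ [_ [a [b ->] <-]]; rewrite setTI; apply: sub_sigma_algebra.
exact/cf/interval_open.
Qed.

Lemma closed_ball_rV_compact n (x : 'rV[R]_n) (r : R) : 0 < r ->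
  compact (closed_ball x r).
Proof.
move=> r0; apply: bounded_closed_compact; last exact: closed_ball_closed.
apply: filterS (nbhs_pinfty_ge (num_real (`|x| + r))) => M rM y.
rewrite closed_ballE// => xy; apply: le_trans rM.
rewrite -lerBlDl; apply: le_trans xy.
by rewrite distrC; exact: lerB_dist.
Qed.

End composition.

(** * Gradient of an expectation by the pathwise derivative *)

Theorem theorem7p1 (R : realType) (U : probability (Omega R) R)
  (hU : product_uniform U) (q d : nat)
  (Y : 'rV[R]_q -> Omega R -> 'rV[R]_d) (hY : sample_smooth Y)
  (h : 'rV[R]_d -> R) (h_smooth : Cinfty h)
  (h_bounded : bounded_fun h) (dh_bounded : bounded_fun (gradient h))
  (hB : forall K : set 'rV[R]_q, compact K ->
    exists B : Omega R -> \bar R,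
      [/\ forall w, (0 <= B w)%E,
          U.-integrable setT B &
          forall w,
            (ereal_sup [set `|dtheta Y theta w|%:E | theta in K] <= B w)%E]) :
  let F := fun theta : 'rV[R]_q =>
    fine (\int[law U Y theta]_x (h x)%:E)%E in
  let G := fun (theta : 'rV[R]_q) (w : Omega R) =>
    (dtheta Y theta w)^T *m gradient h (Y theta w) in
  [/\ forall theta, (law U Y theta).-integrable setT (fun x => (h x)%:E),
      Ck 1 F,
      forall theta, vintegrable U (G theta) &
      forall theta, gradient F theta = vintegral U (G theta)].
Proof.
move=> F G.
have [Y_smooth mY] := hY.
have [dh _] := h_smooth 1%N.
have dY w theta : differentiable (Y ^~ w) theta by have [] := Y_smooth w 1%N.
have mh : measurable_fun setT (h : borel 'rV[R]_d -> R).
  by apply: continuous_borel_measurable => x; exact: differentiable_continuous.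
pose f theta w := h (Y theta w).
have f_int theta : U.-integrable setT (EFin \o f theta).
  apply: measurable_bounded_integrable => //.
  - exact: le_lt_trans (probability_le1 U measurableT) (ltry 1).
  - exact: (measurableT_comp mh (mY theta)).
  - case: h_bounded => M [M_real hM]; exists M; split=> // N MN w _.
    exact: hM MN (Y theta w) I.
have gradE theta w : gradient (f ^~ w) theta = G theta w.
  by rewrite /G /dtheta /Jacobian trmxK -gradient_comp.
have GE theta : (fun w => gradient (f ^~ w) theta) = G theta.
  by apply/funext => w; exact: gradE.
have FE : F = fun theta => \int[U]_w f theta w.
  apply/funext => theta; rewrite /F /law integral_pushforward//.
  - exact/measurable_EFinP.
  - exact: f_int.
have [M M0 hM] := ex_strict_bound_gt0 dh_bounded.
have f_C1 w : Ck 1 (f ^~ w).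
  exact: (Ck1_comp (Y_smooth w 1%N) (h_smooth 1%N)).
have f_dom (theta : 'rV[R]_q) : exists B : Omega R -> \bar R,
    U.-integrable setT B /\
    \forall t \near theta, forall w, (`|gradient (f ^~ w) t|%:E <= B w)%E.
  have [B [B0 iB dYB]] := hB _ (@closed_ball_rV_compact _ _ theta 1 ltr01).
  (* [d * M] comes from the product of matrices; adding 1 keeps [k] positive
     when [d = 0], so that [k%:E * B w] is [+oo] wherever [B w] is. *)
  pose k : R := d%:R * M + 1.
  have k0 : 0 < k by rewrite ltr_wpDl// mulr_ge0// ltW.
  exists (fun w => (k%:E * B w)%E); split; first exact: integrableZl.
  apply/nbhs_ballP; exists 1 => //= t /subset_closed_ball t1 w; rewrite gradE /G.
  have : (`|dtheta Y t w|%:E <= B w)%E.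
    by apply: le_trans (dYB w); apply: ereal_sup_ubound; exists t.
  case: (B w) => [b| |//]; last by move=> _; rewrite gt0_muley ?lte_fin// leey.
  rewrite -EFinM !lee_fin => Yb; apply: le_trans (ler_norm_mulmx _ _) _.
  rewrite mx_norm_tr.
  have b0 : 0 <= b by exact: le_trans Yb.
  apply: (@le_trans _ _ (d%:R * (b * M))).
    by apply: ler_wpM2l => //; apply: ler_pM => //; exact/ltW/hM.
  by rewrite [b * _]mulrC mulrA ler_wpM2r// lerDl.
have [F_C1 F_grad] := C1_under_integral f_int f_C1 f_dom.
split.
- move=> theta; apply: integrable_pushforward => //.
    exact/measurable_EFinP.
  exact: f_int.
- by rewrite FE.
- by move=> theta; rewrite -GE; exact: vintegrable_gradient.
- by move=> theta; rewrite FE -GE F_grad.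
Qed.
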